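(* Let $p$ be a prime number, let $\rho\in(0,\infty]$, and let $S$ be a subset of $\overline{\mathbb{Q}}\cap B(0,\rho)$ such that $0\in S$. Then there exist uncountably many $p$-adic transcendental analytic functions $f\in\overline{\mathbb{Q}}_{\rho}[[z]]$ such that $S_f=S$.
   Context: $p$ is a fixed prime; $\mathbb{C}_p$ is the completion of an algebraic closure of $\mathbb{Q}_p$, with absolute value $|\cdot|$ extending the $p$-adic absolute value normalized by $|p|=p^{-1}$. $\overline{\mathbb{Q}}\subset\mathbb{C}_p$ denotes the set of elements of $\mathbb{C}_p$ algebraic over $\mathbb{Q}$. $B(0,\rho)=\{z\in\mathbb{C}_p:|z|<\rho\}$ is the open disk, with $B(0,\infty)=\mathbb{C}_p$. For $A\subseteq\mathbb{C}_p$ and $\rho\in(0,\infty]$, $A_{\rho}[[z]]$ is the set of all power series $f(z)=\sum_{n\ge 0}a_nz^n$ with all $a_n\in A$ and with radius of convergence (exactly) $\rho$; such an $f$ is regarded as an analytic function $B(0,\rho)\to\mathbb{C}_p$. In particular $\overline{\mathbb{Q}}_{\rho}[[z]]$ is the case $A=\overline{\mathbb{Q}}$. An analytic function $f:\Omega\subseteq\mathbb{C}_p\to\mathbb{C}_p$ is ($p$-adic) transcendental if the only polynomial $P(X,Y)\in\mathbb{C}_p[X,Y]$ with $P(z,f(z))=0$ for all $z\in\Omega$ is the zero polynomial. Its exceptional set is $S_f=\{\alpha\in\Omega\cap\overline{\mathbb{Q}}: f(\alpha)\in\overline{\mathbb{Q}}\}$; for $f\in A_\rho[[z]]$ one takes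 $\Omega=B(0,\rho)$. *)

(* Defs.v *)
From HB Require Import structures.
From mathcomp Require Import all_boot all_order all_algebra.
From mathcomp Require Import polyXY.
From mathcomp Require Import all_classical all_reals all_analysis.

Set Implicit Arguments.
Unset Strict Implicit.
Unset Printing Implicit Defensive.

Import Order.TTheory GRing.Theory Num.Theory.
Import numFieldNormedType.Exports.

Local Open Scope classical_set_scope.
Local Open Scope ring_scope.

Section ValuedFields.
Variable R : realType.

Record ultrametric_abs (F : fieldType) (v : F -> R) : Prop := UltrametricAbs {
  uabs_ge0 : forall x, 0 <= v x;
  uabs_eq0 : forall x, v x = 0 <-> x = 0;
  uabsM : forall x y, v (x * y) = v x * v y;
  uabsD : forall x y, v (x + y) <= Num.max (v x) (v y) }.

(* The fields considered here are not instances of the library's normed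
   modules, so convergence is expressed through the real sequence of
   distances. *)
Definition abs_cvg (F : fieldType) (v : F -> R) (u : nat -> F) (l : F) : Prop :=
  (fun n => v (u n - l)) @ \oo --> (0 : R).

Definition abs_cauchy (F : fieldType) (v : F -> R) (u : nat -> F) : Prop :=
  forall e : R, 0 < e ->
    exists N : nat, forall m n, (N <= m)%N -> (N <= n)%N -> v (u m - u n) < e.

Definition abs_complete (F : fieldType) (v : F -> R) : Prop :=
  forall u : nat -> F, abs_cauchy v u -> exists l, abs_cvg v u l.

(* (E, vE) is a completion of (F, vF) along the embedding i. *)
Record is_completion (F E : fieldType) (vF : F -> R) (vE : E -> R)
    (i : {rmorphism F -> E}) : Prop := IsCompletion {
  completion_ext : forall x, vE (i x) = vF x;
  completion_dense : forall y (e : R), 0 < e -> exists x, vE (y - i x) < e;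
  completion_complete : abs_complete vE }.

Record is_algebraic_closure (F E : fieldType) (i : {rmorphism F -> E}) : Prop :=
  IsAlgebraicClosure {
  closure_algebraic : forall x, algebraicOver i x;
  closure_closed : GRing.closed_field_axiom E }.

(* |p^k * (a / b)| = p^(-k) when p divides neither a nor b. *)
Definition padic_abs (p : nat) (x : rat) : R :=
  if x == 0 then 0
  else p%:R ^+ logn p `|denq x|%N / p%:R ^+ logn p `|numq x|%N.

End ValuedFields.

(* The tower Q -> Q_p -> an algebraic closure of Q_p -> C_p, with absolute
   values. The data are unique up to isometric isomorphism. *)
Structure padic_complex (R : realType) (p : nat) := PadicComplex {
  pc_Qp : fieldType;
  pc_Qpbar : fieldType;
  pc_Cp :> fieldType;
  pc_abs_Qp : pc_Qp -> R;
  pc_abs_Qpbar : pc_Qpbar -> R;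
  pc_abs : pc_Cp -> R;
  pc_in_Qp : {rmorphism rat -> pc_Qp};
  pc_in_Qpbar : {rmorphism pc_Qp -> pc_Qpbar};
  pc_in_Cp : {rmorphism pc_Qpbar -> pc_Cp};
  pc_Qp_uabs : ultrametric_abs pc_abs_Qp;
  pc_Qp_completion : is_completion (@padic_abs R p) pc_abs_Qp pc_in_Qp;
  pc_Qpbar_closure : is_algebraic_closure pc_in_Qpbar;
  pc_Qpbar_uabs : ultrametric_abs pc_abs_Qpbar;
  pc_Qpbar_ext : forall x, pc_abs_Qpbar (pc_in_Qpbar x) = pc_abs_Qp x;
  pc_uabs : ultrametric_abs pc_abs;
  pc_completion : is_completion pc_abs_Qpbar pc_abs pc_in_Cp }.

Arguments pc_abs {R p} K x : rename.

Section PowerSeries.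
Variables (R : realType) (p : nat) (K : padic_complex R p).

Definition Qbar : set K := [set x | algebraicOver (ratr : rat -> K) x].

Definition open_disk (rho : \bar R) : set K :=
  [set z | ((pc_abs K z)%:E < rho)%E].

(* A power series is given by its sequence of coefficients. *)
Definition has_psum (a : nat -> K) (z w : K) : Prop :=
  abs_cvg (pc_abs K) (series (fun n => a n * z ^+ n)) w.

(* The value is the junk 0 where the series diverges. *)
Definition psum (a : nat -> K) (z : K) : K := xget 0 [set w | has_psum a z w].

Definition radius_cvg (a : nat -> K) : \bar R :=
  ereal_sup [set (pc_abs K z)%:E | z in [set z | exists w, has_psum a z w]].

Definition pseries_over (A : set K) (rho : \bar R) : set (nat -> K) :=
  [set a | (forall n, A (a n)) /\ radius_cvg a = rho].

Definition padic_transcendental (Omega : set K) (f : K -> K) : Prop :=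
  forall P : {poly {poly K}}, (forall z, Omega z -> P.[z, f z] = 0) -> P = 0.

Definition exceptional_set (Omega : set K) (f : K -> K) : set K :=
  [set x | (Omega `&` Qbar) x /\ Qbar (f x)].

End PowerSeries.

Arguments Qbar {R p} K.
Arguments open_disk {R p} K rho.

(* Main.v *)
Require Import Defs.
From mathcomp Require Import all_boot all_order all_algebra.
From mathcomp Require Import all_classical all_reals all_analysis.
From mathcomp Require Import polyXY ring zify.

Set Implicit Arguments.
Unset Strict Implicit.
Unset Printing Implicit Defensive.

Import Order.TTheory GRing.Theory Num.Theory.
Import numFieldNormedType.Exports.

Local Open Scope classical_set_scope.
Local Open Scope ring_scope.

(** Since the algebraic numbers are countable, one can enumerate [S] as
    sigma_0, sigma_1, ... and all pairs of algebraic numbers as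
    (alpha_k, beta_k). The series is a sum of widely separated blocks

      f = sum_k c_k z^(n_k) (z - sigma_0) ... (z - sigma_(k-1)),

    whose partial sums F_k are polynomials with algebraic coefficients; c_k is
    a product of powers of p.

    - Values on [S]. The blocks of index k > i vanish at sigma_i, so
      f(sigma_i) = F_(i+1)(sigma_i) is algebraic.
    - Values off [S]. If alpha_k lies in the disk and not in [S], then the k-th
      block is a nonzero multiple of c_k at alpha_k (alpha_k is nonzero because
      0 is in [S]), so all but one c_k give F_(k+1)(alpha_k) <> beta_k. All
      later terms are then kept smaller than the distance between these two
      numbers, whence f(alpha_k) <> beta_k. As every pair of algebraic numbers
      occurs, f(alpha) is transcendental for each such alpha.
    - Radius. The size of c_k is r^-(n_k + k) up to a bounded factor, where
      r <= rho exceeds the radius s of the disk controlled at stage k. On that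
      disk the block is O((s/r)^(n_k)), which a large n_k makes as small as
      required; outside B(0, rho) the top term of the block has absolute value
      at least 1 ([next_stage_exists]).
    - Transcendence. With n_(k+1) much larger than deg F_k, a relation
      P(z, f(z)) = 0 forces P(z, F_k(z)), a polynomial of small degree which
      vanishes to order n_(k+1) at 0, to be zero for infinitely many k; but P
      has only finitely many roots in Y ([lacunary_transcendental]).
    - Uncountability. If the set of such series were listed as g_0, g_1, ...,
      one could also choose c_k different from the corresponding coefficient
      of g_k, and the resulting series would be missing from the list. Each
      stage thus excludes at most two values of c_k, and three candidates of
      comparable size are always available ([exists_Qbar_abs_avoid]).

    The stages are built by [next_stage_exists]; the section on the limit reads
    off the properties of the series from the conditions in [next_stage]. *)

(** * Enumerations and real estimates *)

Lemma countable_enum (T : Type) (A : set T) (x0 : T) : countable A ->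
  exists e : nat -> T, (A x0 -> forall k, A (e k)) /\
    forall x, A x -> exists k, e k = x.
Proof.
move=> /countable_injP[f finj].
pose e k := if pselect (exists x, A x /\ f x = k) is left h
            then projT1 (cid h) else x0.
exists e; split=> [Ax0 k|x Ax].
  by rewrite /e; case: pselect => // h; case: (cid h) => y [].
exists (f x); rewrite /e; case: pselect => [h|[]]; last by exists x.
by case: (cid h) => y [Ay fy] /=; apply: finj fy; rewrite inE.
Qed.

Lemma poly_roots_seq (D : idomainType) (q : {poly D}) : q != 0 ->
  exists s : seq D, forall x, root q x -> x \in s.
Proof.
move=> q0; have [/finite_seqP[s sE]|] := pselect (finite_set [set x | root q x]).
  exists s => x qx.
  suff : [set` s] x by [].
  by rewrite -sE.
move=> /(infinite_set_fset (size q))[B Bq]; rewrite leqNgt.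
rewrite (max_poly_roots q0) // ?finmap.fset_uniq //.
by apply/allP => x xB; exact: Bq.
Qed.

Lemma expr_eventually_lt (R : realType) (x e : R) : 0 <= x < 1 -> 0 < e ->
  exists N, forall n, (N <= n)%N -> x ^+ n < e.
Proof.
move=> /andP[x0 x1] e0.
have /cvg_expr/cvgr0_norm_lt/(_ e e0)[N _ xN] : `|x| < 1 by rewrite ger0_norm.
exists N => n /xN /=; rewrite normrX ger0_norm //.
Qed.

(** The powers of [q], with exponents in Z, meet every multiplicative interval
    of ratio [1 / q]; the exponent is written as a difference [j - k]. *)
Lemma exists_pow_between (R : realType) (q A : R) : 0 < q < 1 -> 0 < A ->
  exists j k, A <= q ^+ j / q ^+ k < A / q.
Proof.
move=> /andP[q0 q1] A0.
have q01 : 0 <= q < 1 by rewrite ltW.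
have [|k /(_ k (leqnn k)) qk] := @expr_eventually_lt _ q A^-1 q01.
  by rewrite invr_gt0.
have qk0 : 0 < q ^+ k by rewrite exprn_gt0.
have Aqk : 0 < A * q ^+ k by rewrite mulr_gt0.
have exj : exists j, q ^+ j < A * q ^+ k.
  by have [j /(_ j (leqnn j))] := expr_eventually_lt q01 Aqk; exists j.
case: (ex_minnP exj) => -[|j] qj minj.
  move: qk; rewrite -[A^-1]mul1r ltr_pdivlMr // mulrC => /(lt_trans qj).
  by rewrite ltxx.
(* [j.+1] is the first exponent for which the power is too small *)
exists j, k; rewrite ler_pdivlMr // ltr_pdivrMr // mulrAC ltr_pdivlMr // -exprSr qj.
rewrite andbT leNgt; apply/negP => /minj; rewrite ltnn.
by [].
Qed.

Lemma real_below (R : realType) (rho : \bar R) : (0 < rho)%E ->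
  exists2 r : R, 0 < r & (r%:E < rho)%E.
Proof.
case: rho => [r r0|_|//]; last by exists 1; rewrite ?ltr01 ?ltry.
by have [m0 mr] := midf_lt r0; exists ((0 + r) / 2).
Qed.

(** The disk of radius [rho], finite or not, is covered by countably many
    smaller ones. *)
Lemma exhaustion (R : realType) (rho : \bar R) : (0 < rho)%E ->
  exists t : nat -> R, (forall k, (t k)%:E < rho)%E /\
    forall x, (x%:E < rho)%E -> exists k, x <= t k.
Proof.
case: rho => [r r0|_|//]; last first.
  exists (fun k => k%:R); split=> [k|x _]; first exact: ltry.
  by exists (Num.bound `|x|); rewrite (le_trans (ler_norm x)) // ltW // archi_boundP.
exists (fun k => r - k.+1%:R^-1); split=> [k|x].
  by rewrite lte_fin ltrBlDr ltrDl invr_gt0 ltr0n.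
rewrite lte_fin -subr_gt0 => xr; exists (Num.bound (r - x)^-1).
have rx : 0 <= (r - x)^-1 by rewrite invr_ge0 ltW.
rewrite lerBrDr addrC -lerBrDr invf_ple ?posrE // ltW // (lt_trans (archi_boundP rx)) //.
by rewrite ltr_nat.
Qed.

Lemma real_between (R : realType) (s : R) (rho : \bar R) : (s%:E < rho)%E ->
  exists2 r, s < r & (r%:E <= rho)%E.
Proof.
case: rho => [r|_|//]; first by rewrite lte_fin; exists r.
by exists (s + 1); rewrite ?ltrDl ?ltr01 ?leey.
Qed.

(** * Ultrametric fields *)

Section Ultrametric.
Variables (R : realType) (F : fieldType) (v : F -> R).
Hypothesis uv : ultrametric_abs v.

Lemma uabs0 : v 0 = 0. Proof. exact/(uabs_eq0 uv). Qed.

Lemma uabs_gt0 x : x != 0 -> 0 < v x.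
Proof.
move=> x0; rewrite lt_neqAle uabs_ge0 // andbT eq_sym.
by apply: contra x0 => /eqP/(uabs_eq0 uv)->.
Qed.

Lemma uabs1 : v 1 = 1.
Proof.
have v1 : v 1 != 0 by rewrite gt_eqF // uabs_gt0 // oner_eq0.
by apply: (mulfI v1); rewrite -(uabsM uv) !mulr1.
Qed.

Lemma uabsX x n : v (x ^+ n) = v x ^+ n.
Proof. by elim: n => [|n IH]; rewrite ?expr0 ?uabs1 // !exprS (uabsM uv) IH. Qed.

Lemma uabsV x : v x^-1 = (v x)^-1.
Proof.
have [->|x0] := eqVneq x 0; first by rewrite invr0 uabs0 invr0.
have vx : v x != 0 by rewrite gt_eqF // uabs_gt0.
by apply: (mulfI vx); rewrite -(uabsM uv) !divff // uabs1.
Qed.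

Lemma uabsN x : v (- x) = v x.
Proof.
apply/eqP; rewrite -(eqrXn2 (n := 2)) ?uabs_ge0 //.
by rewrite -!uabsX sqrrN.
Qed.

Lemma uabsBC x y : v (x - y) = v (y - x).
Proof. by rewrite -uabsN opprB. Qed.

Lemma uabsD_le x y B : v x <= B -> v y <= B -> v (x + y) <= B.
Proof. by move=> xB yB; rewrite (le_trans (uabsD uv _ _)) // ge_max xB yB. Qed.

Lemma uabs_sum_le (I : Type) (r : seq I) (P : pred I) (f : I -> F) B :
  0 <= B -> (forall i, P i -> v (f i) <= B) -> v (\sum_(i <- r | P i) f i) <= B.
Proof.
move=> B0 fB; elim/big_rec: _ => [|i x Pi xB]; first by rewrite uabs0.
exact: uabsD_le (fB i Pi) xB.
Qed.

Lemma uabs_trans y x z B : v (x - y) <= B -> v (y - z) <= B -> v (x - z) <= B.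
Proof. by move=> xy yz; rewrite -(subrKA y); exact: uabsD_le. Qed.

(** The constant [c] lets bounds that are only proportional to [e] be used. *)
Lemma uabs_eq0_small x (c : R) :
  (forall e, 0 < e -> v x <= c * e) -> x = 0.
Proof.
move=> xe; apply/(uabs_eq0 uv)/eqP; rewrite eq_le uabs_ge0 // andbT.
apply/ler_addgt0Pr => e e0; rewrite add0r.
have c0 : 0 < `|c| + 1 by rewrite ltr_wpDl.
rewrite (le_trans (xe (e / (`|c| + 1)) _)) ?divr_gt0 //.
rewrite mulrCA ger_pMr // ler_pdivrMr // mul1r (le_trans (ler_norm c)) //.
by rewrite lerDl.
Qed.

Lemma abs_cvgP (u : nat -> F) l : abs_cvg v u l <->
  forall e, 0 < e -> exists N, forall n, (N <= n)%N -> v (u n - l) < e.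
Proof.
rewrite /abs_cvg; split=> [ul e e0|ul].
  have [N _ uN] := cvgr0_norm_lt _ ul _ e0.
  by exists N => n /uN /=; rewrite ger0_norm ?uabs_ge0.
apply/cvgr0Pnorm_lt => e e0; have [N uN] := ul e e0.
by exists N => // n /uN; rewrite /= ger0_norm ?uabs_ge0.
Qed.

Lemma abs_cvg_terms (u : nat -> F) l : abs_cvg v (series u) l ->
  forall e, 0 < e -> exists N, forall n, (N <= n)%N -> v (u n) < e.
Proof.
move=> /abs_cvgP ul e e0; have [N uN] := ul e e0.
exists N => n Nn.
have -> : u n = (series u n.+1 - l) - (series u n - l).
  by rewrite /series /= big_nat_recr //=; ring.
rewrite (le_lt_trans (uabsD uv _ _)) // uabsN gt_max !uN //.
exact: leqW.
Qed.

(** In an ultrametric field the remainder of a series is bounded by its largest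
    term, so a bound on the terms alone controls the sum. *)
Lemma abs_cvg_series_tail (u : nat -> F) l n B : abs_cvg v (series u) l ->
  0 <= B -> (forall m, (n <= m)%N -> v (u m) <= B) -> v (l - series u n) <= B.
Proof.
move=> /abs_cvgP ul B0 uB.
apply/ler_addgt0Pr => e e0; have [N uN] := ul e e0.
have tB m : (n <= m)%N -> v (series u m - series u n) <= B.
  move=> nm; rewrite /series /= (big_cat_nat (n := n)) //= addrAC subrr add0r.
  by rewrite big_nat; apply: uabs_sum_le => // i /andP[/uB].
apply: (@uabs_trans (series u (maxn N n))).
  rewrite uabsBC (le_trans (ltW (uN _ _))) ?leq_maxl // lerDr //.
by rewrite (le_trans (tB _ _)) ?leq_maxr // lerDl ltW.
Qed.

Lemma abs_cvg_series (u : nat -> F) : abs_complete v ->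
  (forall e, 0 < e -> exists N, forall n, (N <= n)%N -> v (u n) <= e) ->
  exists l, abs_cvg v (series u) l.
Proof.
move=> vc u0; apply: vc => e e0.
have e20 : 0 < e / 2 by rewrite divr_gt0.
have [N uN] := u0 _ e20.
have tB m : (N <= m)%N -> v (series u m - series u N) <= e / 2.
  move=> nm; rewrite /series /= (big_cat_nat (n := N)) //= addrAC subrr add0r.
  by rewrite big_nat; apply: uabs_sum_le => [|i /andP[/uN]]; first exact: ltW.
exists N => m n Nm Nn.
rewrite (@le_lt_trans _ _ (e / 2)) //; last by rewrite ltr_pdivrMr // ltr_pMr // ltr1n.
by apply: (@uabs_trans (series u N)); rewrite 1?uabsBC 1?tB // uabsBC tB.
Qed.

Lemma horner_bound (q : {poly F}) (B : R) : 0 <= B ->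
  exists2 C, 0 <= C & forall z, v z <= B -> v q.[z] <= C.
Proof.
move=> B0; elim/poly_ind: q => [|q c [C C0 qC]].
  by exists 0 => // z _; rewrite horner0 uabs0.
exists (Num.max (C * B) (v c)) => [|z zB]; first by rewrite le_max mulr_ge0.
rewrite hornerMXaddC (le_trans (uabsD uv _ _)) // ge_max !le_max lexx orbT andbT.
by rewrite (uabsM uv) ler_pM ?uabs_ge0 ?qC.
Qed.

(** This transfers a relation [Q(f z, z) = 0] into an upper bound for
    [Q(F z, z)], when [F] approximates [f]. *)
Lemma horner2_lipschitz (q : {poly {poly F}}) (B : R) : 0 <= B ->
  exists2 C, 0 <= C & forall z y y', v z <= B -> v y <= B -> v y' <= B ->
    v (q.[y%:P].[z] - q.[y'%:P].[z]) <= C * v (y - y').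
Proof.
move=> B0.
(* the Lipschitz bound of a product needs a bound of the values too *)
suff [D [C [D0 C0 _ H]]] : exists D C, [/\ 0 <= D, 0 <= C,
    forall z y, v z <= B -> v y <= B -> v (q.[y%:P].[z]) <= D &
    forall z y y', v z <= B -> v y <= B -> v y' <= B ->
    v (q.[y%:P].[z] - q.[y'%:P].[z]) <= C * v (y - y')] by exists C.
elim/poly_ind: q => [|q c [D [C [D0 C0 qD qC]]]].
  by exists 0, 0; split=> // *; rewrite !horner0 ?subrr uabs0 ?mul0r.
have [E E0 cE] := horner_bound c B0.
exists (Num.max (D * B) E), (Num.max (C * B) D).
split=> [||z y zB yB|z y y' zB yB y'B].
- by rewrite le_max E0 orbT.
- by rewrite le_max D0 orbT.
- rewrite hornerMXaddC hornerD hornerM hornerC (le_trans (uabsD uv _ _)) //.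
  rewrite ge_max !le_max cE // orbT andbT.
  by rewrite (uabsM uv) ler_pM ?uabs_ge0 ?qD.
- rewrite !hornerMXaddC !hornerD !hornerM !hornerC.
have -> : q.[y%:P].[z] * y + c.[z] - (q.[y'%:P].[z] * y' + c.[z]) =
  (q.[y%:P].[z] - q.[y'%:P].[z]) * y + q.[y'%:P].[z] * (y - y') by ring.
rewrite maxr_pMl ?uabs_ge0 // (le_trans (uabsD uv _ _)) //.
rewrite !(uabsM uv) ge_max !le_max; apply/andP; split; apply/orP.
  by left; rewrite mulrAC ler_pM ?mulr_ge0 ?uabs_ge0 ?qC.
by right; rewrite ler_pM ?uabs_ge0 ?qD.
Qed.

(** A polynomial of degree less than [N] cannot vanish at 0 to order [N].
    The values at nonzero points suffice, since the powers of [t] tend to 0. *)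
Lemma poly_small_eq0 (t : F) (q : {poly F}) (N : nat) (C d : R) :
  0 < v t < 1 -> 0 < d -> (size q <= N)%N ->
  (forall z, z != 0 -> v z <= d -> v q.[z] <= C * v z ^+ N) -> q = 0.
Proof.
move=> /andP[t0 t1] d0; elim: N q => [|N IH] q.
  by rewrite leqn0 size_poly_eq0 => /eqP.
have [q' [c ->]] : exists q' c, q = q' * 'X + c%:P.
  by elim/poly_ind: q => [|q c _]; [exists 0, 0; rewrite mul0r add0r | exists q, c].
move=> sq qC.
have c0 : c = 0.
  have [C' C'0 q'C] := horner_bound q' (ltW d0).
  apply: (@uabs_eq0_small _ (Num.max `|C| C')) => e e0.
  have de : 0 < Num.min 1 (Num.min d e) by rewrite !lt_min ltr01 d0.
  have [|n /(_ n (leqnn n)) tn] := expr_eventually_lt (x := v t) _ de.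
    by rewrite ltW.
  move: tn; rewrite !lt_min -uabsX => /and3P[z1 zd ze].
  have zn0 : t ^+ n != 0.
    by rewrite expf_neq0 //; apply: contraTneq t0 => ->; rewrite uabs0 ltxx.
  set z := t ^+ n in z1 zd ze zn0.
  have -> : c = (q' * 'X + c%:P).[z] + - (q'.[z] * z) by rewrite hornerMXaddC; ring.
  rewrite maxr_pMl ?(ltW e0) // (le_trans (uabsD uv _ _)) // ge_max !le_max.
  apply/andP; split; apply/orP; [left|right].
    rewrite (le_trans (qC _ zn0 (ltW zd))) //.
    rewrite (le_trans (y := `|C| * v z ^+ N.+1)) ?ler_wpM2r ?exprn_ge0 ?uabs_ge0 ?ler_norm //.
    rewrite ler_wpM2l // exprS (le_trans _ (ltW ze)) // ler_piMr ?uabs_ge0 //.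
    by rewrite exprn_ile1 ?uabs_ge0 // ltW.
  by rewrite uabsN (uabsM uv) ler_pM ?uabs_ge0 ?q'C // ltW.
rewrite c0 addr0 in sq qC *; rewrite (IH q') ?mul0r //.
  have [->|q'0] := eqVneq q' 0; first by rewrite size_poly0.
  by rewrite -ltnS -(size_mulX q'0).
move=> z z0 zd; rewrite -(ler_pM2r (uabs_gt0 z0)) -(uabsM uv).
by rewrite -mulrA -exprSr -[X in q'.[z] * X]hornerX -hornerM qC.
Qed.

End Ultrametric.

(** * The field of p-adic complex numbers *)

Section PadicComplex.
Variables (R : realType) (p : nat) (K : padic_complex R p).
Hypothesis hp : prime p.

Let rat_in_K : {rmorphism rat -> K} :=
  (pc_in_Cp K \o (pc_in_Qpbar K \o pc_in_Qp K))%FUN.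

(** The embedding [ratr] is a ring morphism only in characteristic 0, so the
    closure properties of algebraic numbers are obtained through the morphism
    from the rationals given by the tower of extensions. *)
Lemma QbarE x : Qbar K x <-> algebraicOver rat_in_K x.
Proof.
by rewrite /Qbar /= (_ : ratr = rat_in_K) //; apply/funext => q; rewrite fmorph_eq_rat.
Qed.

Lemma Qbar_nat n : Qbar K n%:R.
Proof. by apply/QbarE; rewrite -(rmorph_nat rat_in_K); exact: algebraic_id. Qed.

Lemma QbarD x y : Qbar K x -> Qbar K y -> Qbar K (x + y).
Proof. by rewrite !QbarE; exact: algebraic_add. Qed.

Lemma QbarB x y : Qbar K x -> Qbar K y -> Qbar K (x - y).
Proof. by rewrite !QbarE; exact: algebraic_sub. Qed.

Lemma QbarM x y : Qbar K x -> Qbar K y -> Qbar K (x * y).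
Proof. by rewrite !QbarE; exact: algebraic_mul. Qed.

Lemma QbarV x : Qbar K x -> Qbar K x^-1.
Proof. by rewrite !QbarE; exact: algebraic_inv. Qed.

Lemma QbarX x n : Qbar K x -> Qbar K (x ^+ n).
Proof.
move=> Qx; elim: n => [|n IH]; first exact: (Qbar_nat 1).
by rewrite exprS; exact: QbarM.
Qed.

Lemma Qbar_sum (I : Type) (r : seq I) (f : I -> K) :
  (forall i, Qbar K (f i)) -> Qbar K (\sum_(i <- r) f i).
Proof.
move=> Qf; elim/big_ind: _ => // [|x y]; first exact: (Qbar_nat 0).
exact: QbarD.
Qed.

Lemma Qbar_horner (q : {poly K}) x :
  (forall i, Qbar K q`_i) -> Qbar K x -> Qbar K q.[x].
Proof.
move=> Qq Qx; rewrite horner_coef; apply: Qbar_sum => i.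
by apply: QbarM => //; exact: QbarX.
Qed.

Lemma Qbar_coefM (q r : {poly K}) :
  (forall i, Qbar K q`_i) -> (forall i, Qbar K r`_i) ->
  forall i, Qbar K (q * r)`_i.
Proof. by move=> Qq Qr i; rewrite coefM; apply: Qbar_sum => j; exact: QbarM. Qed.

Lemma countable_Qbar : countable (Qbar K).
Proof.
pose roots (q : {poly rat}) := [set x : K | q != 0 /\ root (map_poly rat_in_K q) x].
apply: (@sub_countable _ _ _ (\bigcup_(q in [set: {poly rat}]) roots q)).
  by apply: subset_card_le => x /QbarE[q q0 qx]; exists q.
apply: bigcup_countable => [|q _]; first exact: countableP.
have [->|q0] := eqVneq q 0.
  apply: finite_set_countable; rewrite (_ : roots 0 = set0) //.
  by apply/seteqP; split=> x // -[]; rewrite eqxx.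
have : map_poly rat_in_K q != 0 by rewrite map_poly_eq0.
move=> /poly_roots_seq[s qs]; apply: finite_set_countable.
by apply: (@sub_finite_set _ _ [set` s]) => // x [_ /qs].
Qed.

Lemma pc_abs_p : pc_abs K p%:R = p%:R^-1.
Proof.
have -> : p%:R = rat_in_K p%:R :> K by rewrite rmorph_nat.
rewrite /= (completion_ext (pc_completion K)) pc_Qpbar_ext.
rewrite (completion_ext (pc_Qp_completion K)) /padic_abs.
have p0 : (p != 0)%N by rewrite -lt0n prime_gt0.
rewrite pnatr_eq0 (negbTE p0) (_ : p%:R = p%:~R :> rat) // numq_int denq_int /=.
by rewrite logn1 expr0 logn_prime // eqxx expr1 div1r.
Qed.

Lemma pc_abs_p01 : 0 < pc_abs K p%:R < 1.
Proof.
have p1 := prime_gt1 hp.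
by rewrite pc_abs_p invr_gt0 ltr0n prime_gt0 //= invf_lt1 ?ltr1n ?ltr0n ?prime_gt0.
Qed.

(** Because Qpbar is algebraically closed, the value group contains the n-th
    roots of [1 / p]; this is what makes it dense. *)
Lemma pc_abs_root n : (0 < n)%N -> exists x : K, pc_abs K x ^+ n = pc_abs K p%:R.
Proof.
move=> n0.
have [x xn] := Defs.closure_closed (pc_Qpbar_closure K)
  (fun i => if i == 0%N then p%:R else 0) n0.
exists (pc_in_Cp K x); rewrite -(uabsX (pc_uabs K)) -rmorphXn xn.
case: n n0 {xn} => // n _; rewrite big_ord_recl /= expr0 mulr1.
by rewrite big1 ?addr0 ?rmorph_nat // => i _; rewrite mul0r.
Qed.

(** The powers of an n-th root of [p] are spaced with ratio [p^(1/n)], which is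
    closer to 1 than [r / s] for large n. *)
Lemma pc_abs_dense (s r : R) : 0 < s -> s < r -> exists x, s < pc_abs K x < r.
Proof.
move=> s0 sr; have /andP[q0 q1] := pc_abs_p01.
set q := pc_abs K p%:R in q0 q1.
have [m sm mr] : exists2 m, s < m & m < r.
  by exists ((s + r) / 2); rewrite midf_lt.
have m0 := lt_trans s0 sm; have r0 := lt_trans m0 mr.
have [|n0 n0P] := @expr_eventually_lt _ (m / r) q _ q0.
  by rewrite divr_ge0 ?ltW //= ltr_pdivrMr // mul1r.
have mrn : (m / r) ^+ n0.+1 < q by apply: n0P.
have [y yq] := pc_abs_root (ltn0Sn n0).
have y0 : 0 < pc_abs K y.
  rewrite lt_neqAle uabs_ge0 ?andbT; last exact: pc_uabs.
  by apply: contraTneq q0 => yz; rewrite /q -yq -yz exprS mul0r ltxx.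
have y1 : pc_abs K y < 1.
  by rewrite ltNge; apply: contraTN q1 => y1; rewrite -leNgt /q -yq exprn_ege1.
have my : m / pc_abs K y < r.
  rewrite ltr_pdivrMr // mulrC -ltr_pdivrMr //.
  rewrite -(ltr_pXn2r (ltn0Sn n0)) ?nnegrE ?divr_ge0 ?ltW //.
  by rewrite yq.
have y01 : 0 < pc_abs K y < 1 by rewrite y0.
have [j [k /andP[jk1 jk2]]] := exists_pow_between y01 m0.
exists (y ^+ j / y ^+ k).
have uK := pc_uabs K; rewrite (uabsM uK) (uabsV uK) !(uabsX uK).
by rewrite (lt_le_trans sm jk1) (lt_trans jk2 my).
Qed.

End PadicComplex.

(** * Transcendence of lacunary power series *)

Lemma horner2_comp (F : comNzRingType) (Q : {poly {poly F}}) (q : {poly F}) z :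
  Q.[q].[z] = Q.[q.[z]%:P].[z].
Proof.
elim/poly_ind: Q => [|Q c IH]; first by rewrite !horner0.
by rewrite !hornerMXaddC !hornerD !hornerM hornerC IH.
Qed.

(** The degree of [Q(q(z), z)] is at most linear in that of [q]. *)
Lemma size_horner_le (F : comNzRingType) (Q : {poly {poly F}}) :
  exists D : nat, forall (q : {poly F}) n,
    (0 < n)%N -> (size q <= n)%N -> (size Q.[q] <= D * n)%N.
Proof.
exists (\sum_(i < size Q) size (Q`_i)%R + size Q)%N => q n n0 qn.
rewrite horner_coef (leq_trans (size_sum _ _ _)) //.
apply/bigmax_leqP => i _; rewrite (leq_trans (size_polyMleq _ _)) //.
have Qi : (size (Q`_i)%R <= \sum_(i < size Q) size (Q`_i)%R)%N.
  by rewrite (bigD1 i) //= leq_addr.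
have qi : (size (q ^+ i) <= (n.-1 * size Q).+1)%N.
  rewrite (leq_trans (size_poly_exp_leq _ _)) // ltnS leq_mul //.
    by rewrite -!subn1 leq_sub2r.
  exact: ltnW.
move: qi Qi; set A := (\sum_(i < _) _)%N; move: A (size (Q`_i)%R) (size (q ^+ i)%R) => A b c.
by case: n n0 {qn} => // n _ /=; rewrite !mulnS !mulnDl (mulnC n); lia.
Qed.

Section PowerSeries.
Variables (R : realType) (p : nat) (K : padic_complex R p).

Lemma psum_has (a : nat -> K) z w : has_psum a z w -> has_psum a z (psum a z).
Proof. exact: xgetI. Qed.

Lemma series_trunc (a : nat -> K) (q : {poly K}) z :
  (forall i, (i < size q)%N -> a i = q`_i) ->
  series (fun n => a n * z ^+ n) (size q) = q.[z].
Proof.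
by move=> aq; rewrite /series /= horner_coef big_mkord; apply: eq_bigr => i _; rewrite aq.
Qed.

Hypothesis hp : prime p.

(** Let [F] be the truncation of the series at the start [n] of a gap reaching
    up to [D * n]. If [Q(f z, z) = 0] on the disk, then [Q(F z, z)] is
    [O(z^(D * n))], whereas its degree is less than [D * n] when [D] is chosen
    from [Q]; hence [F] is a root of [Q] in the ring of polynomials. Since [Q]
    has finitely many roots and the degrees of the truncations are unbounded,
    [Q = 0]. *)
Lemma lacunary_transcendental (a : nat -> K) (rho : \bar R) : (0 < rho)%E ->
  (forall z, open_disk K rho z -> exists w, has_psum a z w) ->
  (forall n, exists2 m, (n <= m)%N & a m != 0) ->
  (forall D n, exists2 N, (n <= N)%N &
    forall m, (N <= m)%N -> (m < D * N)%N -> a m = 0) ->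
  padic_transcendental (open_disk K rho) (psum a).
Proof.
move=> rho0 acvg anz agap P P0.
have uK := pc_uabs K.
(* a bivariate polynomial is evaluated at [z] in its outer variable, and it is
   the other one that must become the main variable *)
suff : swapXY P = 0 by move/eqP; rewrite swapXY_eq0 => /eqP.
apply: contrapT => /eqP Q0; set Q := swapXY P in Q0.
have [s Qs] := poly_roots_seq Q0.
have [D QD] := size_horner_le Q.
have [w [w0 w1 wrho]] : exists w : K, [/\ w != 0, pc_abs K w <= 1 & open_disk K rho w].
  have [r r0 rrho] := real_below rho0.
  have m0 : 0 < Num.min 1 r by rewrite lt_min ltr01.
  have [m20 m2m] := midf_lt m0.
  have [w] := pc_abs_dense K hp m20 m2m.
  rewrite lt_min => /andP[w0 /andP[w1 wr]]; exists w; split.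
  - by apply: contraTneq w0 => ->; rewrite uabs0 // -leNgt ltW.
  - exact: ltW.
  - by rewrite /open_disk /= (lt_trans _ rrho).
have vw0 := uabs_gt0 uK w0.
have [l al] := acvg w wrho.
have [N0 aN0] := abs_cvg_terms uK al ltr01.
have [m Bm am] := anz (\max_(q <- s) size q).
have [n mn an] := agap D (maxn m.+1 N0).
have {mn}[mn N0n] : (m < n)%N /\ (N0 <= n)%N.
  by split; apply: leq_trans mn; rewrite ?leq_maxl ?leq_maxr.
pose F := \poly_(i < n) a i.
suff /Qs Fs : root Q F.
  have : (size F <= \max_(q <- s) size q)%N by rewrite (big_rem F) //= leq_maxl.
  rewrite leqNgt (leq_ltn_trans Bm) // ltnNge; apply/negP => /leq_sizeP/(_ m (leqnn m)).
  by rewrite coef_poly mn => /eqP; rewrite (negbTE am).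
(* compare with the terms at the fixed point [w], which are at most 1 *)
have tail z : pc_abs K z <= pc_abs K w ->
    pc_abs K (F.[z] - psum a z) <= (pc_abs K z / pc_abs K w) ^+ (D * n).
  move=> zw; have /acvg[f /psum_has af] : open_disk K rho z.
    by rewrite /open_disk /= (le_lt_trans _ wrho) // lee_fin.
  have q0 : 0 <= pc_abs K z / pc_abs K w by rewrite divr_ge0 ?uabs_ge0.
  rewrite uabsBC // /F horner_poly -(big_mkord xpredT (fun i => a i * z ^+ i)).
  apply: (abs_cvg_series_tail uK af); first by rewrite exprn_ge0.
  move=> i ni; have [iDn|Dni] := ltnP i (D * n).
    by rewrite an // mul0r uabs0 // exprn_ge0.
  rewrite (le_trans (y := (pc_abs K z / pc_abs K w) ^+ i)) //; last first.
    by rewrite ler_wiXn2l // ler_pdivrMr // mul1r.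
  have := aN0 i (leq_trans N0n ni); rewrite !(uabsM uK) !(uabsX uK) => ai.
  rewrite expr_div_n ler_pdivlMr ?exprn_gt0 // mulrAC ler_piMl ?exprn_ge0 ?uabs_ge0 //.
  exact: ltW.
have [C1 C10 FC1] := horner_bound uK F ler01.
have B0 : 0 <= Num.max 1 C1 by rewrite le_max ler01.
have [C C0 QC] := horner2_lipschitz uK Q B0.
rewrite /root; apply/eqP.
apply: (poly_small_eq0 uK (C := C / pc_abs K w ^+ (D * n)) (pc_abs_p01 K hp) vw0 (N := D * n)).
  by apply: QD; rewrite ?size_poly // (leq_trans _ mn).
move=> z z0 zw; have zdisk : open_disk K rho z.
  by rewrite /open_disk /= (le_lt_trans _ wrho) // lee_fin.
have z1 : pc_abs K z <= 1 := le_trans zw w1.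
have fz : pc_abs K (psum a z) <= Num.max 1 C1.
  have -> : psum a z = F.[z] - (F.[z] - psum a z) by ring.
  rewrite uabsD_le // ?uabsN // ?le_max ?FC1 ?orbT //.
  rewrite (le_trans (tail z zw)) // exprn_ile1 ?divr_ge0 ?uabs_ge0 //.
  by rewrite ler_pdivrMr // mul1r.
have Qf : Q.[(psum a z)%:P].[z] = 0 by rewrite /Q horner2_swapXY P0.
rewrite horner2_comp -[X in pc_abs K X]subr0 -Qf.
rewrite (le_trans (QC _ _ _ _ _ _)) ?le_max ?z1 ?FC1 ?orbT //; first by rewrite -le_max.
by rewrite mulrAC -mulrA ler_wpM2l // -expr_div_n tail.
Qed.

End PowerSeries.

(** * The inductive construction *)

Section Construction.
Variables (R : realType) (p : nat) (K : padic_complex R p).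
Hypothesis hp : prime p.

(** Three consecutive quotients by [p] of one element have distinct absolute
    values, so one of them differs from both [b1] and [b2]. *)
Lemma exists_Qbar_abs_avoid (A : R) (b1 b2 : K) : 0 < A ->
  exists c, [/\ Qbar K c, A <= pc_abs K c, pc_abs K c <= A / pc_abs K p%:R ^+ 3,
                c != b1 & c != b2].
Proof.
have uK := pc_uabs K; have q01 := pc_abs_p01 K hp.
move=> A0; have [j [k /andP[jk1 jk2]]] := exists_pow_between q01 A0.
have /andP[q0 q1] := q01; set q := pc_abs K p%:R in q0 q1 jk1 jk2 *.
pose c i : K := p%:R ^+ j / p%:R ^+ k / p%:R ^+ i.
have vc i : pc_abs K (c i) = q ^+ j / q ^+ k / q ^+ i.
  by rewrite !(uabsM uK) !(uabsV uK) !(uabsX uK).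
have cgood i : (i <= 2)%N -> [/\ Qbar K (c i), A <= pc_abs K (c i) &
    pc_abs K (c i) <= A / q ^+ 3].
  move=> i2; have Qp n : Qbar K (p%:R ^+ n) by apply: QbarX; exact: Qbar_nat.
  split.
  - by rewrite /c; do 2 (apply: QbarM; last exact: QbarV).
  - rewrite vc (le_trans jk1) // ler_pdivlMr ?exprn_gt0 // ler_piMr //.
      by rewrite (le_trans (ltW A0)).
    by rewrite exprn_ile1 ?ltW.
  - rewrite vc (exprS q 2) invfM mulrA ler_pM ?(ltW jk2) ?divr_ge0 ?invr_ge0 ?exprn_ge0 ?(ltW q0) //.
    by rewrite lef_pV2 ?posrE ?exprn_gt0 // ler_wiXn2l ?ltW.
have cinj : injective c.
  have p0 : p%:R != 0 :> K by apply: contraTneq q0 => p0; rewrite /q p0 uabs0 ?ltxx.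
  have cn0 : p%:R ^+ j / p%:R ^+ k != 0 :> K by rewrite mulf_neq0 ?invr_eq0 ?expf_neq0.
  move=> i i' /(mulfI cn0)/invr_inj /(congr1 (pc_abs K)).
  rewrite !(uabsX uK) -/q => qi; apply/eqP; rewrite eqn_leq.
  by rewrite -!(ler_iXn2l q0 q1) qi lexx.
have c01 : c 0%N != c 1%N by apply/eqP => /cinj.
have c02 : c 0%N != c 2 by apply/eqP => /cinj.
have c12 : c 1%N != c 2 by apply/eqP => /cinj.
suff [i i2 /andP[]] : exists2 i, (i <= 2)%N & (c i != b1) && (c i != b2).
  by have [] := cgood i i2; exists (c i).
have [/eqP b01|nb01] := eqVneq (c 0%N) b1; last first.
  have [b02|nb02] := eqVneq (c 0%N) b2; last by exists 0%N; rewrite ?nb01.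
  have [b11|nb11] := eqVneq (c 1%N) b1; last by exists 1%N; rewrite ?nb11 // -b02 eq_sym.
  by exists 2; rewrite // -b11 -b02 !(eq_sym (c 2)) c12.
have [b12|nb12] := eqVneq (c 1%N) b2.
  by exists 2; rewrite // -(eqP b01) -b12 !(eq_sym (c 2)) c02.
by exists 1%N; rewrite // nb12 -(eqP b01) eq_sym c01.
Qed.

Variables (rho : \bar R) (t : nat -> R).
Hypothesis rho_gt0 : (0 < rho)%E.
Hypothesis t_rho : forall k, ((t k)%:E < rho)%E.
Hypothesis t_exhaust : forall x, (x%:E < rho)%E -> exists k, x <= t k.
Variables (sigma alpha beta : nat -> K) (g : nat -> nat -> K).
Hypothesis sigma_Qbar : forall i, Qbar K (sigma i).
Hypothesis sigma_disk : forall i, open_disk K rho (sigma i).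
Hypothesis sigma0 : exists i, sigma i = 0.

(** A stage consists of a partial sum [trunc], a bound [err] for the terms of
    all later blocks, and the radius [rad] of the disk on which that bound is
    to hold. *)
Record stage := Stage { trunc : {poly K}; err : R; rad : R }.

Definition stage_ok (x : stage) : Prop :=
  [/\ forall m, Qbar K (trunc x)`_m, 0 < err x, 0 < rad x & ((rad x)%:E < rho)%E].

(** The points of the disk at which an algebraic value has to be avoided, if
    they are algebraic. *)
Definition critical (z : K) : Prop :=
  open_disk K rho z /\ forall i, sigma i <> z.

(** The conditions refer to the two truncations only, and not to the exponent
    and the coefficient of the new block. [ns_long] and [ns_gap] create the gap
    that yields transcendence; [ns_small] and [ns_large] fix the radius of
    convergence; [ns_interp] and [ns_avoid] decide the values of the series at
    the points of [S] and off [S]; [ns_diag] makes the series different from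
    [g k]. *)
Record next_stage (k : nat) (x y : stage) : Prop := NextStage {
  ns_ok : stage_ok y;
  ns_size : (size (trunc x) < size (trunc y))%N;
  ns_long : (k * size (trunc x) < size (trunc y))%N;
  ns_coef : forall m, (m < size (trunc x))%N -> (trunc y)`_m = (trunc x)`_m;
  ns_gap : forall m, (size (trunc x) <= m)%N -> (m < k * size (trunc x))%N ->
    (trunc y)`_m = 0;
  ns_small : forall m z, (size (trunc x) <= m)%N -> pc_abs K z <= rad x ->
    pc_abs K ((trunc y)`_m * z ^+ m) <= err x;
  ns_large : exists2 m, (size (trunc x) <= m < size (trunc y))%N &
    forall z, (rho <= (pc_abs K z)%:E)%E -> 1 <= pc_abs K ((trunc y)`_m * z ^+ m);
  ns_diag : exists2 m, (m < size (trunc y))%N & (trunc y)`_m <> g k m;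
  ns_interp : forall i, (i < k)%N -> (trunc y).[sigma i] = (trunc x).[sigma i];
  ns_avoid : critical (alpha k) ->
    pc_abs K (alpha k) <= rad y /\
    err y < pc_abs K ((trunc y).[alpha k] - beta k);
  ns_err : err y <= err x / 2;
  ns_rad : rad x <= rad y;
  ns_exhaust : t k <= rad y }.

(** If [c] has size at most [A / r^(n + d)], then on the disk of radius [s < r]
    the terms of the block [c z^n P(z)] are [O((s / r)^n)]. *)
Lemma block_small (P : {poly K}) (d : nat) (e s A : R) :
  0 < e -> 0 < s -> forall r, s < r -> exists n0, forall n c, (n0 <= n)%N ->
  pc_abs K c <= A / r ^+ (n + d) ->
  forall m z, pc_abs K z <= s -> (m <= d)%N ->
  pc_abs K (c * P`_m * z ^+ (n + m)) <= e.
Proof.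
have uK := pc_uabs K.
move=> e0 s0 r sr; have r0 := lt_trans s0 sr.
pose M := \sum_(i < size P) pc_abs K P`_i.
have M0 : 0 <= M by apply: sumr_ge0 => i _; exact: uabs_ge0.
have PM m : pc_abs K P`_m <= M.
  have [mP|mP] := ltnP m (size P); last by rewrite nth_default // uabs0.
  rewrite /M (bigD1 (Ordinal mP)) //= lerDl.
  by apply: sumr_ge0 => i _; exact: uabs_ge0.
pose s1 := Num.max 1 s ^+ d.
have s10 : 1 <= s1 by rewrite /s1 exprn_ege1 // le_max lexx.
pose B := `|A| / r ^+ d * M * s1.
have B0 : 0 <= B.
  by rewrite !mulr_ge0 ?invr_ge0 ?exprn_ge0 ?(ltW r0) // le_max ler01.
have [||n0 n0P] := @expr_eventually_lt _ (s / r) (e / (B + 1)).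
- by rewrite divr_ge0 ?ltW //= ltr_pdivrMr // mul1r.
- by rewrite divr_gt0 // ltr_wpDl.
exists n0 => n c /n0P nP cA m z zs md.
have zsm : pc_abs K z ^+ m <= s1.
  rewrite (le_trans (y := Num.max 1 s ^+ m)) //; last by rewrite ler_weXn2l // le_max lexx.
  by rewrite lerXn2r ?nnegrE ?(uabs_ge0 uK) // ?le_max ?ler01 ?zs ?orbT.
have zsn : pc_abs K z ^+ n <= s ^+ n by rewrite lerXn2r ?nnegrE ?uabs_ge0 // ltW.
have cA' : pc_abs K c <= `|A| / r ^+ d / r ^+ n.
  rewrite (le_trans cA) // -mulrA -invfM -exprD (addnC d).
  by rewrite ler_wpM2r ?ler_norm // invr_ge0 exprn_ge0 // ltW.
rewrite !(uabsM uK) (uabsX uK) exprD.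
rewrite (le_trans (y := (`|A| / r ^+ d / r ^+ n) * M * (s ^+ n * s1))) //.
  by rewrite !ler_pM ?mulr_ge0 ?exprn_ge0 ?uabs_ge0.
rewrite [leLHS](_ : _ = (s / r) ^+ n * B); last first.
  by rewrite expr_div_n /B; ring.
apply: (le_trans (y := e / (B + 1) * B)); first by rewrite ler_wpM2r // ltW.
by rewrite mulrAC ler_pdivrMr ?ltr_wpDl // ler_pM2l // lerDl.
Qed.

Lemma next_stage_exists k x : stage_ok x -> exists y, next_stage k x y.
Proof.
case: x => F e s [/= QF e0 s0 srho].
have uK := pc_uabs K.
have [r sr rrho] := real_between srho.
have r0 := lt_trans s0 sr.
pose P := \prod_(i < k) ('X - (sigma i)%:P).
have Pmon : P \is monic by exact: monic_prod_XsubC.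
have sP : size P = k.+1 by rewrite /P -big_enum size_prod_XsubC size_enum_ord.
have Plead : P`_k = 1 by move/monicP: Pmon; rewrite lead_coefE sP.
have QP : forall m, Qbar K P`_m.
  rewrite /P; elim/big_rec: _ => [m|i q _ Qq]; first by rewrite coef1; exact: Qbar_nat.
  apply: Qbar_coefM => // m; rewrite coefB coefX coefC.
  by apply: QbarB; [exact: Qbar_nat | case: ifP => _ //; exact: (Qbar_nat K 0)].
have Psigma i : (i < k)%N -> P.[sigma i] = 0.
  move=> ik; rewrite /P horner_prod (bigD1 (Ordinal ik)) //= hornerXsubC.
  by rewrite subrr mul0r.
pose q := pc_abs K p%:R.
have [n0 n0P] := block_small P k (q ^+ 3)^-1 e0 s0 sr.
(* large enough for [block_small], and for the gap that starts at [size F] *)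
pose n := maxn n0 (k.+1 * (size F)).
have n0n : (n0 <= n)%N by rewrite leq_maxl.
have Fn : (k.+1 * size F <= n)%N by rewrite leq_maxr.
have Fn1 : (size F <= n)%N by rewrite (leq_trans _ Fn) // leq_pmull.
have kFn : (k * size F <= n)%N by rewrite (leq_trans _ Fn) // leq_mul2r leqnSn orbT.
(* the only coefficient for which the new truncation takes the value [beta k]
   at [alpha k] *)
pose b2 := (beta k - F.[alpha k]) / (P.[alpha k] * alpha k ^+ n).
have A0 : 0 < (r ^+ (n + k))^-1 by rewrite invr_gt0 exprn_gt0.
have [c [Qc cr cq cg cb]] := exists_Qbar_abs_avoid (g k (n + k)%N) b2 A0.
pose F' := F + c *: (P * 'X^n).
have F'E m : F'`_m = F`_m + (if (m < n)%N then 0 else c * P`_(m - n)).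
  by rewrite coefD coefZ coefMXn; case: ifP; rewrite ?mulr0.
have c0 : c != 0 by apply: contraTneq cr => ->; rewrite uabs0 // -ltNge.
have sF' : size F' = (n + k).+1.
  have sB : size (c *: (P * 'X^n)) = (n + k).+1.
    by rewrite size_scale // size_mulXn ?monic_neq0 // sP addnS.
  by rewrite /F' addrC size_polyDl // sB ltnS (leq_trans Fn1) // leq_addr.
have F'lead : F'`_(n + k) = c.
  rewrite F'E nth_default ?(leq_trans Fn1) ?leq_addr //.
  by rewrite ltnNge leq_addr /= addKn Plead mulr1 add0r.
have F'eval z : F'.[z] = F.[z] + c * (P.[z] * z ^+ n).
  by rewrite /F' hornerD hornerZ hornerM hornerXn.
have [s' [ss' ts' s'rho s'alpha]] : exists s', [/\ s <= s', t k <= s', (s'%:E < rho)%E &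
    critical (alpha k) -> pc_abs K (alpha k) <= s'].
  pose s1 := Num.max s (t k).
  have s1rho : (s1%:E < rho)%E by rewrite /s1 /Num.max; case: ifP.
  have [[adisk _]|ncrit] := pselect (critical (alpha k)).
    exists (Num.max s1 (pc_abs K (alpha k))).
    rewrite !le_max !lexx !orbT; split=> //.
    by rewrite /Num.max; case: ifP.
  by exists s1; rewrite !le_max !lexx orbT; split.
have [e' [e'0 e'e e'beta]] : exists e', [/\ 0 < e', e' <= e / 2 &
    critical (alpha k) -> e' < pc_abs K (F'.[alpha k] - beta k)].
  have e20 : 0 < e / 2 by rewrite divr_gt0.
  have [[adisk asigma]|ncrit] := pselect (critical (alpha k)); last by exists (e / 2); split.
  have a0 : alpha k != 0 by apply/eqP => a0; case: sigma0 => i si; apply: (asigma i); rewrite si.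
  have Pa : P.[alpha k] * alpha k ^+ n != 0.
    rewrite mulf_neq0 ?expf_neq0 // /P horner_prod; apply/prodf_neq0 => i _.
    by rewrite hornerXsubC subr_eq0; apply/eqP => ai; exact: (asigma i).
  have d0 : 0 < pc_abs K (F'.[alpha k] - beta k).
    apply: (uabs_gt0 uK); rewrite F'eval subr_eq0; apply: contra cb => /eqP Fb.
    by rewrite /b2 -Fb addrAC subrr add0r mulfK.
  exists (Num.min (e / 2) (pc_abs K (F'.[alpha k] - beta k) / 2)); split.
  - by rewrite lt_min e20 divr_gt0.
  - by rewrite ge_min lexx.
  - by move=> _; rewrite gt_min [X in _ || X]ltr_pdivrMr // ltr_pMr // ltr1n orbT.
exists (Stage F' e' s'); split=> //=.
- split=> //=; last exact: lt_le_trans ss'.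
  move=> m; rewrite F'E; apply: QbarD => //; case: ifP => _; first exact: (Qbar_nat K 0).
  exact: QbarM.
- by rewrite sF' ltnS (leq_trans Fn1) // leq_addr.
- by rewrite sF' ltnS (leq_trans kFn) // leq_addr.
- by move=> m mF; rewrite F'E (leq_trans mF Fn1) addr0.
- move=> m Fm mF; rewrite F'E (leq_trans mF kFn) addr0 nth_default //.
- move=> m z Fm zs; rewrite F'E nth_default // add0r.
  have [mn|nm] := ltnP m n; first by rewrite mul0r uabs0 // ltW.
  have [mk|mk] := leqP (m - n) k.
    rewrite -[in z ^+ m](subnKC nm); apply: n0P => //.
    by rewrite mulrC.
  by rewrite nth_default ?sP // mulr0 mul0r uabs0 // ltW.
- exists (n + k)%N; first by rewrite sF' leqnn (leq_trans Fn1) ?leq_addr.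
  move=> z rz; rewrite F'lead (uabsM uK) (uabsX uK).
  have rz' : r <= pc_abs K z by rewrite -lee_fin (le_trans rrho).
  rewrite -[leLHS](mulVf (x := r ^+ (n + k))); last by rewrite gt_eqF // exprn_gt0.
  by rewrite ler_pM ?invr_ge0 ?exprn_ge0 ?(ltW r0) // lerXn2r ?nnegrE ?uabs_ge0 ?(ltW r0).
- by exists (n + k)%N; [rewrite sF' | rewrite F'lead; exact/eqP].
- by move=> i ik; rewrite F'eval Psigma // mul0r mulr0 addr0.
- by move=> crit; split; [exact: s'alpha | exact: e'beta].
Qed.

(** * The limit of the construction *)

Section Limit.
Variable X : nat -> stage.
Hypothesis X0 : stage_ok (X 0).
Hypothesis X_next : forall k, next_stage k (X k) (X k.+1).

(** The m-th coefficient no longer changes from stage [m.+1] on. *)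
Definition limit_coef (m : nat) : K := (trunc (X m.+1))`_m.

Let uK := pc_uabs K.
Local Notation T k := (trunc (X k)).
Local Notation a := limit_coef.

Lemma X_ok k : stage_ok (X k).
Proof. by case: k => // k; exact: ns_ok (X_next k). Qed.

Lemma trunc_size_mono : {homo (fun k => size (T k)) : j k / (j <= k)%N}.
Proof.
apply: homo_leq => [//|? ? ?|k]; first exact: leq_trans.
exact: ltnW (ns_size (X_next k)).
Qed.

Lemma trunc_size_ge k : (k <= size (T k))%N.
Proof. by elim: k => // k /leq_ltn_trans -> //; exact: ns_size (X_next k). Qed.

Lemma err_mono j k : (j <= k)%N -> err (X k) <= err (X j).
Proof.
apply: (homo_leq (f := fun k => err (X k)) (r := fun x y => y <= x)) => [//||i].
- by move=> y x z xy yz; exact: le_trans yz xy.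
- rewrite (le_trans (ns_err (X_next i))) // ler_pdivrMr // ler_peMr ?ler1n //.
  by have [_ /ltW] := X_ok i.
Qed.

Lemma rad_mono j k : (j <= k)%N -> rad (X j) <= rad (X k).
Proof.
apply: (homo_leq (f := fun k => rad (X k)) (r := <=%R)) => [//||i].
  by move=> y x z; exact: le_trans.
exact: ns_rad (X_next i).
Qed.

Lemma err_small e : 0 < e -> exists k, err (X k) <= e.
Proof.
move=> e0; have errk k : err (X k) <= 2^-1 ^+ k * err (X 0).
  elim: k => [|k IH]; first by rewrite expr0 mul1r.
  rewrite (le_trans (ns_err (X_next k))) // exprSr mulrAC ler_wpM2r //.
have [_ e00 _ _] := X0.
have [||k /(_ k (leqnn k)) ke] := @expr_eventually_lt _ (2^-1 : R) (e / err (X 0)).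
- by rewrite invr_ge0 ler0n invf_lt1 ?ltr1n.
- by rewrite divr_gt0.
by exists k; rewrite (le_trans (errk k)) // -ler_pdivlMr // ltW.
Qed.

Lemma disk_rad z : open_disk K rho z -> exists k, pc_abs K z <= rad (X k).
Proof.
by case/t_exhaust => k zk; exists k.+1; rewrite (le_trans zk) // (ns_exhaust (X_next k)).
Qed.

Lemma rad_disk z k : pc_abs K z <= rad (X k) -> open_disk K rho z.
Proof. by have [_ _ _] := X_ok k; rewrite -lee_fin => ? /le_lt_trans; apply. Qed.

Lemma trunc_coef k j m : (k <= j)%N -> (m < size (T k))%N -> (T j)`_m = (T k)`_m.
Proof.
move=> kj mk; elim: j kj => [|j IH]; first by rewrite leqn0 => /eqP->.
rewrite leq_eqVlt => /predU1P[->//|]; rewrite ltnS => kj.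
by rewrite (ns_coef (X_next j)) ?IH // (leq_trans mk) // trunc_size_mono.
Qed.

Lemma limit_coefE k m : (m < size (T k))%N -> a m = (T k)`_m.
Proof.
move=> mk; have [km|mk'] := leqP k m.+1; first exact: trunc_coef.
by rewrite [RHS](@trunc_coef m.+1) ?trunc_size_ge // ltnW.
Qed.

(** Bounds for a coefficient come from the block to which it belongs, which can
    be any block after the k-th truncation. *)
Lemma limit_coef_block k m : (size (T k) <= m)%N ->
  exists2 j, (k <= j)%N & (size (T j) <= m < size (T j.+1))%N.
Proof.
move=> km; have exj : exists j, (m < size (T j))%N.
  by exists m.+1; exact: trunc_size_ge.
have [[|j] mj minj] := ex_minnP exj.
  by move: mj; rewrite ltnNge (leq_trans _ km) // trunc_size_mono.
exists j; last by rewrite mj andbT leqNgt; apply/negP => /minj; rewrite ltnn.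
rewrite -ltnS ltnNge; apply/negP => /trunc_size_mono /(leq_trans mj).
by rewrite ltnNge km.
Qed.

Lemma limit_coef_small k m z : (size (T k) <= m)%N -> pc_abs K z <= rad (X k) ->
  pc_abs K (a m * z ^+ m) <= err (X k).
Proof.
move=> /limit_coef_block[j kj /andP[jm mj]] zk; rewrite (limit_coefE mj).
rewrite (le_trans _ (err_mono kj)) // (ns_small (X_next j)) //.
exact: le_trans (rad_mono kj).
Qed.

Lemma limit_has_psum z : open_disk K rho z -> has_psum a z (psum a z).
Proof.
case/disk_rad => k zk.
suff [w] : exists w, has_psum a z w by exact: psum_has.
apply: (abs_cvg_series uK) => [|e e0].
  exact: completion_complete (pc_completion K).
have [j je] := err_small e0.
exists (size (T (maxn k j))) => n /limit_coef_small nkj.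
apply: (le_trans (nkj _ _)).
  by rewrite (le_trans zk) // rad_mono // leq_maxl.
by rewrite (le_trans _ je) // err_mono // leq_maxr.
Qed.

Lemma limit_tail k z : pc_abs K z <= rad (X k) ->
  pc_abs K (psum a z - (T k).[z]) <= err (X k).
Proof.
move=> zk; rewrite -(@series_trunc _ _ _ a); last exact: limit_coefE.
apply: (abs_cvg_series_tail uK).
- exact: limit_has_psum (rad_disk zk).
- by have [_ /ltW] := X_ok k.
- by move=> m km; exact: limit_coef_small.
Qed.

(** The value group is dense, so the supremum of the absolute values of the
    points of convergence reaches [rho] as soon as the series converges on the
    open disk. Beyond [rho] infinitely many terms have size at least 1. *)
Lemma limit_radius : radius_cvg a = rho.
Proof.
apply/eqP; rewrite eq_le; apply/andP; split.
  apply: ge_ereal_sup => _ [z [w aw] <-]; rewrite leNgt; apply/negP => rz.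
  have [N aN] := abs_cvg_terms uK aw ltr01.
  have [m /andP[Nm mN] /(_ z (ltW rz))] := ns_large (X_next N).
  rewrite -(limit_coefE mN) leNgt aN // (leq_trans _ Nm) //.
  exact: trunc_size_ge.
set D := radius_cvg a.
have disk_le z : open_disk K rho z -> ((pc_abs K z)%:E <= D)%E.
  move=> /limit_has_psum az; apply: ereal_sup_ubound.
  by exists z => //; exists (psum a z).
rewrite leNgt; apply/negP => Drho.
have D0 : (0 <= D)%E.
  by have := disk_le 0; rewrite /open_disk /= (uabs0 uK); exact.
case: D D0 Drho disk_le => [u| |] //; last by move=> _; rewrite ltNge leey.
rewrite lee_fin => u0 urho disk_le.
have [r ur rrho] := real_between urho.
have [us sr] := midf_lt ur.
have [z /andP[sz zr]] := pc_abs_dense K hp (le_lt_trans u0 us) sr.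
have /disk_le : open_disk K rho z.
  by rewrite /open_disk /= (lt_le_trans _ rrho) // lte_fin.
by rewrite lee_fin leNgt (lt_trans us).
Qed.

(** The nonzero coefficients required far out are the leading ones of the
    truncations. *)
Lemma limit_transcendental : padic_transcendental (open_disk K rho) (psum a).
Proof.
apply: (lacunary_transcendental hp rho_gt0) => [z|n|D n].
- by move=> /limit_has_psum; exists (psum a z).
- have nT : (n < size (T n.+1))%N by exact: trunc_size_ge.
  have T0 : (0 < size (T n.+1))%N by exact: leq_trans nT.
  exists (size (T n.+1)).-1; first by rewrite -ltnS prednK.
  rewrite (@limit_coefE n.+1) ?prednK // -lead_coefE lead_coef_eq0.
  by rewrite -size_poly_gt0.
- pose k := maxn D n.
  exists (size (T k)); first by rewrite (leq_trans (leq_maxr D n)) // trunc_size_ge.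
  move=> m km mD; have mk : (m < k * size (T k))%N.
    by rewrite (leq_trans mD) // leq_mul2r leq_maxl orbT.
  rewrite (@limit_coefE k.+1); first exact: (ns_gap (X_next k)).
  exact: ltn_trans (ns_long (X_next k)).
Qed.

(** From stage [i.+1] on, all blocks vanish at [sigma i]. *)
Lemma limit_sigma i : psum a (sigma i) = (T i.+1).[sigma i].
Proof.
have Tsigma k : (i < k)%N -> (T k).[sigma i] = (T i.+1).[sigma i].
  elim: k => // k IH; rewrite ltnS leq_eqVlt => /predU1P[->//|ik].
  by rewrite (ns_interp (X_next k)) // IH.
have [k sk] := disk_rad (sigma_disk i).
apply/eqP; rewrite -subr_eq0; apply/eqP.
apply: (uabs_eq0_small uK (c := 1)) => e e0; rewrite mul1r.
have [j je] := err_small e0; pose l := maxn i.+1 (maxn k j).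
have kl : (k <= l)%N by rewrite !leq_max leqnn orbT.
have jl : (j <= l)%N by rewrite !leq_max leqnn !orbT.
rewrite -(Tsigma l); last by rewrite leq_max leqnn.
rewrite (le_trans (limit_tail (le_trans sk (rad_mono kl)))) //.
exact: le_trans (err_mono jl) je.
Qed.

Lemma limit_exceptional :
  (forall x y, Qbar K x -> Qbar K y -> exists k, alpha k = x /\ beta k = y) ->
  exceptional_set (open_disk K rho) (psum a) = range sigma.
Proof.
move=> alphabeta; apply/seteqP; split=> [x [[xdisk Qx] Qfx]|_ [i _ <-]]; last first.
  split; first by split; [exact: sigma_disk | exact: sigma_Qbar].
  rewrite limit_sigma; apply: Qbar_horner; last exact: sigma_Qbar.
  by have [] := X_ok i.+1.
apply: contrapT => xS; have [k [ax bx]] := alphabeta _ _ Qx Qfx.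
have crit : critical (alpha k).
  by rewrite ax; split=> // i si; apply: xS; exists i.
have [ar] := ns_avoid (X_next k) crit.
by rewrite bx ax (uabsBC uK) ltNge limit_tail // -ax.
Qed.

End Limit.

End Construction.

(** * Existence and uncountability *)

Lemma next_stage_seq (R : realType) (p : nat) (hp : prime p)
    (K : padic_complex R p) (rho : \bar R) (t : nat -> R)
    (sigma alpha beta : nat -> K) (g : nat -> nat -> K) :
  (0 < rho)%E -> (forall k, ((t k)%:E < rho)%E) -> (forall i, Qbar K (sigma i)) ->
  (exists i, sigma i = 0) ->
  exists X : nat -> stage K, stage_ok rho (X 0) /\
    forall k, next_stage rho t sigma alpha beta g k (X k) (X k.+1).
Proof.
move=> rho0 trho sigmaQ sigma0.
have [s s0 srho] := real_below rho0.
pose x0 : stage K := Stage 0 1 s.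
have /choice[f fP] : forall kx : nat * stage K, exists y, stage_ok rho kx.2 ->
    next_stage rho t sigma alpha beta g kx.1 kx.2 y.
  move=> [k x]; have [okx|nok] := pselect (stage_ok rho x); last by exists x0.
  have [y xy] := next_stage_exists hp trho alpha beta g sigmaQ sigma0 k okx.
  by exists y.
pose X k := nat_rect (fun=> stage K) x0 (fun i x => f (i, x)) k.
have ok0 : stage_ok rho (X 0).
  by split=> //= m; rewrite coef0; exact: (Qbar_nat K 0).
have Xok k : stage_ok rho (X k).
  by elim: k => // k IH; exact: ns_ok (fP (k, X k) IH).
by exists X; split=> // k; exact: fP (k, X k) (Xok k).
Qed.

Theorem theorem2 (R : realType) (p : nat) (hp : prime p)
    (K : padic_complex R p) (rho : \bar R) (hrho : (0 < rho)%E)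
    (S : set K) (hS : S `<=` Qbar K `&` open_disk K rho) (hS0 : S 0) :
  ~ countable
      [set a : nat -> K |
        [/\ pseries_over (Qbar K) rho a,
            padic_transcendental (open_disk K rho) (psum a) &
            exceptional_set (open_disk K rho) (psum a) = S]].
Proof.
move=> /(countable_enum (fun=> 0))[g [_ gP]].
have [sigma [/(_ hS0) sigmaS Ssigma]] : exists e : nat -> K,
    (S 0 -> forall k, S (e k)) /\ forall x, S x -> exists k, e k = x.
  apply: countable_enum; apply: sub_countable (countable_Qbar K).
  by apply: subset_card_le => x /hS[].
have [ab [_ abP]] := countable_enum (0, 0)
  (countableX (countable_Qbar K) (countable_Qbar K)).
have [t [trho texh]] := exhaustion hrho.
have sQ i : Qbar K (sigma i) by have [] := hS _ (sigmaS i).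
have sD i : open_disk K rho (sigma i) by have [] := hS _ (sigmaS i).
have [X [X0 XP]] := next_stage_seq hp (fst \o ab) (snd \o ab) g hrho trho sQ (Ssigma 0 hS0).
have [k gk] : exists k, g k = limit_coef X.
  apply: gP; split.
  - split; last exact (limit_radius hp hrho texh X0 XP).
    by move=> n; have [Q _ _ _] := X_ok X0 XP n.+1; exact: Q.
  - exact (limit_transcendental hp hrho texh X0 XP).
  - rewrite (limit_exceptional texh sQ sD X0 XP); last first.
      by move=> x y Qx Qy; have [k kxy] := abP (x, y) (conj Qx Qy); exists k; rewrite /= kxy.
    apply/seteqP; split=> [_ [i _ <-]//|x /Ssigma[i]]; by exists i.
have [m mk] := ns_diag (XP k).
by rewrite gk (limit_coefE XP mk).
Qed.
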